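(* Let $w\in S_n$. Then $w$ is equivalent to $\mathrm{id}_n=12\cdots n$ under the $S_c$-equivalence if and only if $w$ is $c$-toothed.
   Context: Fix positive integers $c\le n$. $S_m$ is the set of permutations of $\{1,\dots,m\}$ written as words. A word $w_1\cdots w_c$ (distinct integer letters) forms $u\in S_c$ if there is an integer $k$ with $w_i=u_i+k$ for all $i$. An $S_c$-hit in $w\in S_n$ is a contiguous subword of length $c$ forming some $u\in S_c$; an $S_c$-rearrangement rearranges the letters of an $S_c$-hit arbitrarily in place. The $S_c$-equivalence is the reflexive-transitive closure of $S_c$-rearrangement on $S_n$. Tail size of a nonempty word $w$ with distinct letters: least $k\ge1$ such that the first $k$ letters of $w$ are the $k$ smallest letters of $w$. Irreducible blocks: the empty word has none; otherwise, if $k$ is the tail size of $w$, $a$ the first $k$ letters and $b$ the remaining letters, then $B_1(w)=a$ and $B_i(w)=B_{i-1}(b)$ for $i>1$ whenever $B_{i-1}(b)$ exists. A permutation $w$ is $c$-toothed if (1) every irreducible block satisfies $|B_i(w)|\le c$, and (2) there is a set of consecutive indices $I=\{i_1,\dots,i_t\}$ with $\sum_{i\in I}|B_i(w)|=c$. *)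

(* Defs.v *)
From Stdlib Require Export Relation_Operators.
From mathcomp Require Export all_boot all_order all_algebra.

Set Implicit Arguments.
Unset Strict Implicit.
Unset Printing Implicit Defensive.

Definition perm_words (m : nat) : pred (seq nat) :=
  [pred w | perm_eq w (iota 1 m)].

Definition id_word (n : nat) : seq nat := iota 1 n.

Definition forms (w u : seq nat) : Prop :=
  exists k : int, [seq x%:Z | x <- w]%R = [seq x%:Z + k | x <- u]%R.

Definition is_hit (c : nat) (h : seq nat) : Prop :=
  exists2 u, u \in perm_words c & forms h u.

Definition rearrangement (c : nat) (w w' : seq nat) : Prop :=
  exists p h h' s : seq nat,
    [/\ w = p ++ h ++ s, is_hit c h, perm_eq h' h & w' = p ++ h' ++ s].

(* Reflexivity makes the closure relate every [w : seq nat] to itself, so the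
   relation is meaningful only for words in [perm_words n]. *)
Definition Sc_equiv (n c : nat) : seq nat -> seq nat -> Prop :=
  clos_refl_trans (seq nat)
    (fun w w' => [/\ w \in perm_words n, w' \in perm_words n
                   & rearrangement c w w']).

Definition initial_smallest (w : seq nat) (k : nat) : bool :=
  perm_eq (take k w) (take k (sort leq w)).

(* The least [k] with [1 <= k <= size w] satisfying [initial_smallest w k];
   [k = size w] always qualifies. Junk value 1 on the empty word. *)
Definition tail_size (w : seq nat) : nat :=
  (find (initial_smallest w) (iota 1 (size w))).+1.

(* Blocks are indexed from 1; [None] means that the block does not exist. *)
Fixpoint block (i : nat) (w : seq nat) : option (seq nat) :=
  match i, w with
  | 0, _ | _, [::] => None
  | 1, _ => Some (take (tail_size w) w)
  | i'.+1, _ => block i' (drop (tail_size w) w)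
  end.

Definition block_size (i : nat) (w : seq nat) : nat :=
  size (odflt [::] (block i w)).

(* The set of consecutive indices is [{i | a <= i < b}]; every index in it must
   be the index of an existing block. *)
Definition toothed (c : nat) (w : seq nat) : Prop :=
  (forall i B, block i w = Some B -> size B <= c) /\
  (exists a b : nat,
     (forall i, a <= i < b -> isSome (block i w)) /\
     \sum_(a <= i < b) block_size i w = c).

(* Main.v *)
Require Import Defs.
From mathcomp Require Import all_boot all_order all_algebra.
From mathcomp Require Import zify.

(** Call [k] a cut of [w] if the first [k] letters of [w] rearrange [1..k]; the
    blocks of [w] are the pieces between consecutive cuts.  Then [w] is [c]-toothed iff
    every window of [c] consecutive positive integers [<= n] contains a cut and
    two cuts are at distance [c].
    When the cuts are this dense, a hit ends and begins at cuts: a cut strictly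
    inside the hit forces the values of the hit to be its positions.  So a
    rearrangement changes only the cuts strictly inside the hit, and
    [c]-toothedness is preserved.
    Conversely, sort the letters between two cuts at distance [c], so that all
    positions in this window become cuts.  The next cut [j] to the right of the
    window is at distance at most [c], hence [j - c] is a cut in the window, and
    sorting the letters between [j - c] and [j] enlarges the window;
    similarly on the left, until it is the whole word. *)

(** * Cuts of a word, and what remains after dropping a prefix at a cut *)

(* [cut m] is meant for words that rearrange [iota m n], such as the tail left
   after removing the first block of a permutation. *)
Definition cut (m : nat) (w : seq nat) (k : nat) : bool :=
  (k <= size w) && perm_eq (take k w) (iota m k).

(** With [sh] the list of block sizes, these sums are the cuts; the default 0 keeps them constant
    past the end of [sh]. *)
Definition partial_sum (sh : seq nat) (i : nat) : nat :=
  \sum_(0 <= j < i) nth 0 sh j.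

Lemma cut0 m w : cut m w 0.
Proof. by rewrite /cut take0. Qed.

Lemma cut_cat (m : nat) (p s : seq nat) :
  perm_eq p (iota m (size p)) -> cut m (p ++ s) (size p).
Proof. by move=> hp; rewrite /cut size_cat leq_addr take_size_cat. Qed.

Lemma cut_drop (m : nat) (w : seq nat) t j :
  cut m w t -> cut m w (t + j) = cut (m + t) (drop t w) j.
Proof.
case/andP=> ht hp; rewrite /cut size_drop leq_subRL //.
congr (_ && _); rewrite takeD iotaD.
by rewrite (permPl (perm_cat hp (perm_refl _))) perm_cat2l.
Qed.

Lemma perm_drop_cut (m : nat) (w : seq nat) t :
  perm_eq w (iota m (size w)) -> cut m w t ->
  perm_eq (drop t w) (iota (m + t) (size (drop t w))).
Proof.
move=> hw hc; have /andP[ht _] := hc.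
have := cut_drop m w t (size (drop t w)) hc.
rewrite size_drop subnKC // /cut leqnn take_size hw size_drop leqnn /=.
by rewrite -size_drop take_size => <-.
Qed.

(** * Blocks as the pieces between consecutive cuts *)

Lemma initial_smallest_cut (m : nat) (w : seq nat) k :
  perm_eq w (iota m (size w)) -> k <= size w -> initial_smallest w k = cut m w k.
Proof.
move=> hw hk; rewrite /initial_smallest /cut hk.
suff -> : sort leq w = iota m (size w) by rewrite take_iota (minn_idPl hk).
rewrite (perm_sortP leq_total leq_trans anti_leq _ _ hw).
by apply: sorted_sort; [exact: leq_trans | exact: iota_sorted].
Qed.

Lemma tail_sizeP (m : nat) (w : seq nat) :
  perm_eq w (iota m (size w)) -> 0 < size w ->
  [/\ tail_size w <= size w, cut m w (tail_size w)
    & forall k, 0 < k < tail_size w -> ~~ cut m w k].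
Proof.
move=> hw w0; rewrite /tail_size.
have hall : cut m w (size w) by rewrite /cut leqnn take_size.
have hh : has (initial_smallest w) (iota 1 (size w)).
  apply/hasP; exists (size w); first by rewrite mem_iota; lia.
  by rewrite (initial_smallest_cut m) // leqnn.
have hf := hh; rewrite has_find size_iota in hf.
split=> //.
  rewrite -(initial_smallest_cut m) //.
  by have := nth_find 0 hh; rewrite nth_iota.
move=> [//|k]; rewrite ltnS => /= hk.
have kw : k < size w by apply: ltn_trans hf.
rewrite -(initial_smallest_cut m) //.
by have := before_find 0 hk; rewrite nth_iota // add1n => ->.
Qed.

Lemma partial_sum0 sh : partial_sum sh 0 = 0.
Proof. by rewrite /partial_sum big_nil. Qed.

Lemma partial_sumS sh i :
  partial_sum sh i.+1 = partial_sum sh i + nth 0 sh i.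
Proof. by rewrite /partial_sum big_nat_recr. Qed.

Lemma partial_sum_cons t sh i :
  partial_sum (t :: sh) i.+1 = t + partial_sum sh i.
Proof. by rewrite /partial_sum big_nat_recl. Qed.

Lemma partial_sum_range sh i j : i <= j ->
  \sum_(i <= l < j) nth 0 sh l = partial_sum sh j - partial_sum sh i.
Proof. by move=> ij; rewrite /partial_sum (big_cat_nat (leq0n i) ij) addKn. Qed.

Lemma leq_partial_sum sh i j :
  i <= j -> partial_sum sh i <= partial_sum sh j.
Proof.
move=> /subnKC <-; elim: (j - i) => [|d IH]; first by rewrite addn0.
by rewrite addnS partial_sumS; lia.
Qed.

(** Peeling off the first block leaves a word on the interval starting at [m + t], hence the
    induction over all [m]. Minimality of the tail size makes 0 the only cut below [t]; the other
    cuts are those of the rest, shifted by [t]. *)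
Lemma block_cuts (m : nat) (w : seq nat) :
  perm_eq w (iota m (size w)) -> exists sh : seq nat,
  [/\ size w = partial_sum sh (size sh),
      forall i, omap size (block i.+1 w) = onth sh i
    & forall k, cut m w k <-> exists2 i, i <= size sh & k = partial_sum sh i].
Proof.
have [N leN] := ubnP (size w); elim: N => // N IH in m w leN *.
case: (posnP (size w)) => [/size0nil -> _|w0 hw].
  exists [::]; split=> //; first by rewrite partial_sum0.
    by case.
  move=> k; split; last by case=> -[|//] _ ->; rewrite partial_sum0 cut0.
  by rewrite /cut leqn0 => /andP[/eqP-> _]; exists 0; rewrite ?partial_sum0.
have [tw tc tmin] := tail_sizeP m w hw w0.
set t := tail_size w in tw tc tmin.
have t0 : 0 < t by [].
have hv := perm_drop_cut m w t hw tc.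
have sv := size_drop t w.
have vN : size (drop t w) < N by lia.
have [sh [shs shb shc]] := IH _ _ vN hv.
exists (t :: sh); split.
- by rewrite /= partial_sum_cons -shs sv subnKC.
- move=> [|i]; last by rewrite -[onth _ _]/(onth sh i) -shb /t; case: (w) w0.
  have -> : block 1 w = Some (take t w) by rewrite /t; case: (w) w0.
  by rewrite /= size_take_min (minn_idPl tw).
- clearbody t; move=> k; have [kt|tk] := ltnP k t.
    split=> [ck|[[|i] _ ek]]; last 2 first.
    + by rewrite ek partial_sum0 cut0.
    + by move: kt; rewrite ek partial_sum_cons; lia.
    case: k kt ck => [|k] kt ck; first by exists 0; rewrite ?partial_sum0.
    by have /negP := tmin k.+1 kt.
  rewrite -(subnKC tk) cut_drop // shc; split=> [[i ii ->]|[[|i] ii]].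
  + by exists i.+1; rewrite ?partial_sum_cons.
  + by rewrite partial_sum0 => e; exists 0; rewrite ?partial_sum0; lia.
  + by rewrite partial_sum_cons => /addnI; exists i.
Qed.

(** * Toothedness in terms of cuts *)

Definition cuts_dense (c : nat) (w : seq nat) : Prop :=
  forall x, x + c <= size w -> exists2 k, x < k <= x + c & cut 1 w k.

Definition cut_toothed (c : nat) (w : seq nat) : Prop :=
  cuts_dense c w /\ exists p, cut 1 w p && cut 1 w (p + c).

(** A block longer than [c] starting at a cut [q] would leave no cut among [q + 1, ..., q + c].
    Consecutive blocks of total size [c] lie between two cuts at distance [c]. *)
Lemma toothedE (c : nat) (w : seq nat) : 0 < c -> perm_eq w (iota 1 (size w)) ->
  toothed c w <-> cut_toothed c w.
Proof.
move=> c0 hw; have [sh [shs shb shc]] := block_cuts _ _ hw.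
have shI i : isSome (block i.+1 w) = (i < size sh).
  by rewrite -onthTE -shb; case: (block _ _).
have shS i : block_size i.+1 w = nth 0 sh i.
  by rewrite -odflt_onth -shb /block_size; case: (block _ _).
have sum_sh a b : \sum_(a.+1 <= i < b.+1) block_size i w
    = \sum_(a <= i < b) nth 0 sh i.
  by rewrite big_add1; apply: eq_bigr => i _; rewrite shS.
have le_shs i : partial_sum sh i <= size w.
  have [h|h] := leqP i (size sh); first by rewrite shs leq_partial_sum.
  rewrite shs -(subnKC (ltnW h)); elim: (i - size sh) => [|d IH].
    by rewrite addn0.
  by rewrite addnS partial_sumS nth_default ?leq_addr ?addn0.
split=> [[small [a [b [hab sab]]]]|
        [dense [p /andP[/shc[i ii ->] /shc[j jj hj]]]]].
- split=> [x hx|].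
    (* The block containing position [x], counted from 0, has size at most [c], so it ends at a cut
       in the window. *)
    have [i] : exists2 i, i < size sh &
        partial_sum sh i <= x < partial_sum sh i.+1.
      have : x < partial_sum sh (size sh) by rewrite -shs; lia.
      move: (leqnn (size sh)); move: {1 3}(size sh) => s.
      elim: s => [|s IH] hs; first by rewrite partial_sum0.
      have [h _|h h'] := ltnP x (partial_sum sh s); first by apply: IH; lia.
      by exists s => //; rewrite h.
    move=> ii /andP[h1 h2]; exists (partial_sum sh i.+1); last first.
      by apply/shc; exists i.+1.
    rewrite h2 partial_sumS -shS.
    have : isSome (block i.+1 w) by rewrite shI.
    case E: (block i.+1 w) => [B|//] _.
    have := small _ _ E; rewrite /block_size E /=; lia.
  have ab : a < b.
    by rewrite ltnNge; apply/negP => ba; move: sab c0; rewrite big_geq // => <-.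
  (* Blocks are numbered from 1, so the range of indices cannot contain 0. *)
  case: a b hab sab ab => [|a] [|b] // hab sab ab.
    by have := hab 0 isT; case: (w).
  have bs : b <= size sh.
    by case: b hab sab ab => // b hab _ ab; rewrite -shI hab //; lia.
  move: sab; rewrite sum_sh (partial_sum_range sh a b (ltnW ab)) => sab.
  have le_ab := leq_partial_sum sh a b (ltnW ab).
  exists (partial_sum sh a); apply/andP; split; apply/shc.
    by exists a; first by lia.
  by exists b => //; lia.
- split.
    move=> [|l] B; first by case: (w).
    move=> E; have ll : l < size sh by rewrite -shI E.
    have sB : size B = nth 0 sh l by rewrite -shS /block_size E.
    (* If no window of length [c] fits after the start of the block, the end of the word already
       bounds its size. *)
    have [h|h] := leqP (partial_sum sh l + c) (size w); last first.
      by have := le_shs l.+1; rewrite partial_sumS; lia.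
    have [k /andP[h1 h2]] := dense _ h.
    case/shc=> [r _ kr]; rewrite sB.
    have lr : l < r.
      rewrite ltnNge; apply/negP => rl.
      by have := leq_partial_sum sh r l rl; lia.
    by have := leq_partial_sum sh l.+1 r lr; rewrite partial_sumS; lia.
  have ij : i <= j.
    rewrite leqNgt; apply/negP => ji.
    by have := leq_partial_sum sh j i (ltnW ji); lia.
  exists i.+1, j.+1; split.
    by move=> [|l] // hl; rewrite shI; lia.
  by rewrite sum_sh partial_sum_range //; lia.
Qed.

(** * Hits, and the invariance of toothedness under rearrangement *)

(** The shift [k] is an integer and may be negative; taking [m] to be the letter of [h] that matches
    the letter 1 of [u] keeps everything in [nat]. *)
Lemma is_hit_interval (c : nat) (h : seq nat) :
  0 < c -> is_hit c h -> exists m, perm_eq h (iota m c).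
Proof.
move=> c0 [u]; rewrite inE => hu [k hk].
have u1 : 1 \in u by rewrite (perm_mem hu) mem_iota; lia.
have : (1%:Z + k)%R \in [seq x%:Z | x <- h]%R.
  by rewrite hk; apply/mapP; exists 1.
case/mapP=> m _ hm; exists m.
have -> : h = [seq m + y.-1 | y <- u].
  have Pinj : injective Posz by move=> x y [].
  apply: (inj_map Pinj); rewrite hk -map_comp; apply/eq_in_map => y yu /=.
  have : 0 < y by move: yu; rewrite (perm_mem hu) mem_iota => /andP[].
  lia.
rewrite (permPl (perm_map _ hu)).
suff -> : [seq m + y.-1 | y <- iota 1 c] = iota m c by [].
by rewrite (iotaDl 1 0) -map_comp -{2}(addn0 m) iotaDl.
Qed.

Lemma interval_is_hit (p c : nat) (h : seq nat) :
  perm_eq h (iota p.+1 c) -> is_hit c h.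
Proof.
move=> hh; exists [seq x - p | x <- h].
  rewrite inE (permPl (perm_map _ hh)) -(addn1 p) iotaDl -map_comp.
  by rewrite (eq_map (_ : _ =1 id)) ?map_id // => x /=; rewrite addKn.
exists (Posz p); rewrite -map_comp; apply/eq_in_map => x.
rewrite (perm_mem hh) mem_iota /=; lia.
Qed.

(** A prefix that does not end strictly inside the infix contains all of it or nothing of it. *)
Lemma cut_perm_infix (m : nat) (p h h' s : seq nat) k : perm_eq h h' ->
  (k <= size p) || (size p + size h <= k) ->
  cut m (p ++ h ++ s) k = cut m (p ++ h' ++ s) k.
Proof.
move=> hh /orP[hk|hk]; rewrite /cut !size_cat (perm_size hh).
  by rewrite !takel_cat.
rewrite !catA !take_cat !size_cat -(perm_size hh) ltnNge hk /=.
by congr andb; apply: (permPl _); rewrite perm_cat2r perm_cat2l.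
Qed.

(** The cut [j] splits [h] by value: the letters before it are at most [j], those after it exceed
    [j]. So [h1] consists of the values from [m] to [j], and counting them gives [m = 1 + size p];
    removing them from [1, ..., j] leaves the letters of [p]. *)
Lemma cut_inside_interval (c m j : nat) (p h s : seq nat) :
  let w := p ++ h ++ s in
  perm_eq w (iota 1 (size w)) -> perm_eq h (iota m c) -> cut 1 w j ->
  size p < j < size p + c -> cut 1 w (size p) && cut 1 w (size p + c).
Proof.
move=> w hw hh cj /andP[pj jc].
have sh : size h = c by rewrite (perm_size hh) size_iota.
have tj : take j w = p ++ take (j - size p) h.
  by rewrite take_cat ltnNge (ltnW pj) /= takel_cat ?sh //; lia.
have dj : drop j w = drop (j - size p) h ++ s.
  by rewrite drop_cat ltnNge (ltnW pj) /= drop_cat sh ifT //; lia.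
set h1 := take _ h in tj; set h2 := drop _ h in dj.
have sh1 : size h1 = j - size p by rewrite size_takel ?sh //; lia.
have pt : perm_eq (p ++ h1) (iota 1 j) by rewrite -tj; case/andP: cj.
have h1j : [seq x <- h1 | x <= j] = h1.
  apply/all_filterP/allP => x xh.
  have : x \in iota 1 j by rewrite -(perm_mem pt) mem_cat xh orbT.
  by rewrite mem_iota; lia.
have h2j : [seq x <- h2 | x <= j] = [::].
  apply/eqP; rewrite -[_ == _]negbK -has_filter; apply/hasPn => x xh.
  have : x \in drop j w by rewrite dj mem_cat xh.
  by rewrite (perm_mem (perm_drop_cut _ _ _ hw cj)) mem_iota; lia.
have ph1 : perm_eq h1 [seq x <- iota m c | x <= j].
  rewrite -(permPr (perm_filter _ hh)) -(cat_take_drop (j - size p) h).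
  by rewrite filter_cat -/h1 -/h2 h1j h2j cats0.
(* As [j] is strictly inside the hit, [h1] is neither empty nor all of [h], so [j] falls within the
   interval of values, before its last one. *)
have mj : m <= j.
  rewrite leqNgt; apply/negP => jm.
  move: (perm_size ph1); rewrite (@eq_in_filter _ _ pred0) ?filter_pred0 /=.
    by lia.
  by move=> x; rewrite mem_iota /=; lia.
have jmc : j - m < c.
  rewrite ltnNge; apply/negP => cjm.
  move: (perm_size ph1); rewrite (@eq_in_filter _ _ predT) ?filter_predT /=.
    by rewrite size_iota; lia.
  by move=> x; rewrite mem_iota /=; lia.
have := filter_iota_leq m jmc; rewrite subnKC // => fm; rewrite fm in ph1.
have em : m = 1 + size p by move: (perm_size ph1); rewrite size_iota sh1; lia.
have pp : perm_eq p (iota 1 (size p)).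
  rewrite -(perm_cat2r h1); apply: (perm_trans pt).
  rewrite -(subnKC (ltnW pj)) iotaD -em perm_cat2l perm_sym.
  by rewrite (_ : (j - m).+1 = j - size p) in ph1; last by lia.
rewrite {1}/w cut_cat //= /w catA.
have -> : size p + c = size (p ++ h) by rewrite size_cat sh.
by apply: cut_cat; rewrite size_cat sh iotaD perm_cat // -em.
Qed.

Lemma cut_interval (c m : nat) (p h s : seq nat) :
  let w := p ++ h ++ s in
  0 < c -> perm_eq w (iota 1 (size w)) -> cuts_dense c w ->
  perm_eq h (iota m c) -> cut 1 w (size p) && cut 1 w (size p + c).
Proof.
move=> w c0 hw dense hh.
have inside := @cut_inside_interval c m _ p h s hw hh.
have sw : size p + c <= size w.
  by rewrite /w !size_cat (perm_size hh) size_iota; lia.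
have [j /andP[pj jc] cj] := dense _ sw.
move: jc; rewrite leq_eqVlt => /orP[/eqP ej|jc]; last first.
  by apply: (inside j); rewrite ?pj.
subst j; rewrite cj andbT.
(* The only cut found so far is the right end of the hit. The window moved one step to the left
   excludes it, so its cut is either the left end or strictly inside. *)
have [->|p0] := posnP (size p); first exact: cut0.
have [|i /andP[pi ic] ci] := dense (size p).-1; first by lia.
have [->//|ip] := eqVneq (size p) i.
by have /andP[] := inside i ci ltac:(lia).
Qed.

(** The ends of the hit are cuts of [w'], hence of [w], and supply the two cuts at distance [c].
    Only cuts strictly inside the hit can be lost. *)
Lemma cut_toothed_infix (c : nat) (p h h' s : seq nat) :
  let w := p ++ h ++ s in let w' := p ++ h' ++ s in
  0 < c -> perm_eq w' (iota 1 (size w')) ->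
  is_hit c h -> perm_eq h' h -> cut_toothed c w' -> cut_toothed c w.
Proof.
move=> w w' c0 hw' /(is_hit_interval _ _ c0) [m hm] hh [dense _].
have hm' : perm_eq h' (iota m c) by rewrite (permPl hh).
have /andP[cp cpc] := cut_interval c m p h' s c0 hw' dense hm'.
have sh : size h = c by rewrite (perm_size hm) size_iota.
have cutE k : (k <= size p) || (size p + c <= k) -> cut 1 w k = cut 1 w' k.
  by move=> hk; apply: cut_perm_infix; rewrite ?sh // perm_sym.
have sww : size w = size w' by rewrite /w /w' !size_cat (perm_size hh).
rewrite -cutE ?leqnn // in cp; rewrite -cutE ?leqnn ?orbT // in cpc.
split; last by exists (size p); rewrite cp.
move=> x; rewrite sww => /dense [j jx cj].
have [hj|] := boolP ((j <= size p) || (size p + c <= j)).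
  by exists j; rewrite ?cutE.
rewrite negb_or -!ltnNge => /andP[pj jc].
(* The window is as long as the hit and meets its inside, so it contains an end of the hit, which
   replaces the lost cut. *)
have [px|px] := ltnP x (size p); first by exists (size p) => //; lia.
by exists (size p + c) => //; lia.
Qed.

(** * Sorting a toothed word by rearrangements *)

(** Between the cuts [p] and [p + c] lie exactly the values [p + 1, ..., p + c], so these letters
    form a hit and may be put in increasing order. *)
Lemma sort_window (c n p : nat) (w : seq nat) : w \in perm_words n ->
  cut 1 w p -> cut 1 w (p + c) -> exists w' : seq nat,
  [/\ w' \in perm_words n, rearrangement c w w',
      forall k, cut 1 w k -> cut 1 w' k
    & forall k, p <= k <= p + c -> cut 1 w' k].
Proof.
rewrite inE => hw cp cpc; have /andP[pw pp] := cp; have /andP[pcw ppc] := cpc.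
set P := take p w in pp; set h := take c (drop p w); set s := drop (p + c) w.
have ew : w = P ++ h ++ s.
  by rewrite /s addnC -drop_drop cat_take_drop cat_take_drop.
have sP : size P = p by rewrite size_takel.
have ph : perm_eq h (iota p.+1 c).
  move: ppc; rewrite takeD iotaD -/h.
  rewrite -(permPr (perm_cat pp (perm_refl (iota p.+1 c)))).
  by rewrite perm_cat2l.
have sh : size h = c by rewrite (perm_size ph) size_iota.
have window k : p <= k <= p + c -> cut 1 (P ++ iota p.+1 c ++ s) k.
  move=> /andP[pk kpc]; rewrite -(subnKC pk) catA.
  have -> : iota p.+1 c = iota p.+1 (k - p) ++ iota k.+1 (p + c - k).
    have -> : k.+1 = p.+1 + (k - p) by lia.
    by rewrite -iotaD; congr iota; lia.
  rewrite catA -[_ ++ s]catA.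
  have -> : p + (k - p) = size (P ++ iota p.+1 (k - p)).
    by rewrite size_cat sP size_iota.
  by apply: cut_cat; rewrite size_cat sP size_iota iotaD perm_cat.
exists (P ++ iota p.+1 c ++ s); split=> //.
- rewrite inE -(permPr hw) ew perm_cat2l perm_cat2r perm_sym //.
- exists P, h, (iota p.+1 c), s; split=> //; first exact: interval_is_hit ph.
  by rewrite perm_sym.
- move=> k ck; have [/window //|nk] := boolP (p <= k <= p + c).
  rewrite -(cut_perm_infix _ _ h) // -?ew ?sP ?sh //.
  by lia.
Qed.

Lemma all_cuts_iota (m : nat) (w : seq nat) :
  (forall k, k <= size w -> cut m w k) -> w = iota m (size w).
Proof.
elim: w m => // x w IH m cutw /=.
have ex : x = m.
  have /andP[_] := cutw 1 isT.
  by rewrite /= take0 => /perm_mem/(_ x); rewrite !inE eqxx => /esym/eqP.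
congr cons => //; apply: IH => k kw.
have := cut_drop m (x :: w) 1 k (cutw 1 isT).
by rewrite add1n cutw // addn1 /= drop0.
Qed.

Lemma Sc_equiv_sorted_window (c n l r : nat) (w : seq nat) :
  0 < c -> w \in perm_words n -> cuts_dense c w -> l + c <= r <= n ->
  (forall k, l <= k <= r -> cut 1 w k) -> Sc_equiv n c w (id_word n).
Proof.
move=> c0; have [d led] := ubnP (n - (r - l)).
elim: d => // d IH in l r w led *; move=> hw dense /andP[lr rn] cuts.
have sw : size w = n by rewrite (perm_size hw) size_iota.
(* Common to both directions of growth: sorting the [c] letters after [p] turns the window from [l]
   to [r] into the larger one from [l'] to [r'], leaving fewer positions outside. *)
have step p l' r' : l' + c <= r' -> r' <= n -> r - l < r' - l' ->
    cut 1 w p -> cut 1 w (p + c) ->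
    (forall k, l' <= k <= r' -> (p <= k <= p + c) || (l <= k <= r)) ->
    Sc_equiv n c w (id_word n).
  move=> lr' rn' grow cp cpc sub.
  have [w' [hw' rear keep window]] := sort_window _ _ _ _ hw cp cpc.
  apply: (@rt_trans _ _ _ w'); first by apply: rt_step; split.
  apply: (IH l' r') => //; first by lia.
  - move=> x; rewrite (perm_size hw') size_iota -sw => /dense[k kx ck].
    by exists k => //; apply: keep.
  - by rewrite lr'.
  - move=> k /sub /orP[/window //|/cuts]; exact: keep.
have [rn'|nr] := ltnP r n.
  have [j /andP[rj jr] cj] : exists2 j, r < j <= r + c & cut 1 w j.
    have [h|h] := leqP (r + c) n; first by apply: dense; rewrite sw.
    (* Near the right end, the end of the word itself serves as the next cut. *)
    exists n; first by rewrite rn' ltnW.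
    by rewrite /cut sw leqnn -sw take_size sw.
  have jn : j <= n by rewrite -sw; case/andP: cj.
  apply: (step (j - c) l j) => //; try lia.
  - by apply: cuts; lia.
  - by rewrite subnK //; lia.
have [l0|l0] := posnP l.
  have -> : w = id_word n.
    by rewrite /id_word -sw; apply: all_cuts_iota => k kw; apply: cuts; lia.
  exact: rt_refl.
(* The window [(l - c).-1] asks for a cut from [l - c] to [l - 1]; near the left end the cut 0
   serves. *)
have [j /andP[jl lj] cj] : exists2 j, j < l <= j + c & cut 1 w j.
  have [h|h] := leqP l c; first by exists 0; rewrite ?cut0 ?l0.
  have [|j hj cj] := dense (l - c).-1; first by lia.
  by exists j => //; lia.
apply: (step j j r) => //; try lia.
by apply: cuts; lia.
Qed.

Theorem theorem4p5 (c n : nat) (hc : 0 < c) (hcn : c <= n)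
  (w : seq nat) (hw : w \in perm_words n) :
  Sc_equiv n c w (id_word n) <-> toothed c w.
Proof.
have permE v : v \in perm_words n -> perm_eq v (iota 1 (size v)).
  by move=> hv; rewrite (perm_size hv) size_iota.
rewrite toothedE ?permE //; split.
  (* Toothedness is carried backwards along the chain of rearrangements, starting from the
     identity. *)
  have : cut_toothed c (id_word n).
    have cuts k : k <= n -> cut 1 (id_word n) k.
      by move=> kn; rewrite /cut size_iota kn take_iota (minn_idPl kn) /=.
    split; last by exists 0; rewrite !cuts.
    by move=> x; rewrite size_iota => xn; exists (x + c); rewrite ?cuts //; lia.
  move=> hid eqv; move: hid.
  elim: eqv => // [x y [hx hy [p [h [h' [s [ex hit ph ey]]]]]]|
                   x y z _ IHxy _ IHyz].
    by subst x y; apply: (cut_toothed_infix c p h h' s) => //; exact: permE.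
  by move/IHyz/IHxy.
case=> dense [p /andP[cp cpc]].
have [w' [hw' rear keep window]] := sort_window _ _ _ _ hw cp cpc.
apply: (@rt_trans _ _ _ w'); first by apply: rt_step; split.
apply: (Sc_equiv_sorted_window c n p (p + c)) => //.
  move=> x; rewrite (perm_size hw') -(perm_size hw) => /dense[k kx ck].
  by exists k => //; apply: keep.
by rewrite leqnn -(size_iota 1 n) -(perm_size hw); case/andP: cpc.
Qed.
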